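(* Let $n \geq 1$ and $b \ge 0$ be integers and let $d = 2\lceil \log n\rceil + 3$. If there is a $b$-bit protocol for the orthogonal vectors problem in which Alice and Bob each hold $n$ vectors of dimension $d$, then there is a $b$-bit protocol for the set disjointness problem in which Alice and Bob each hold an $n$-dimensional bit vector.
   Context: All problems are in the standard two-party communication model: Alice and Bob each hold a private input and exchange bits according to a protocol in order to determine the answer; a $b$-bit protocol is one in which at most $b$ bits are exchanged in total (in the worst case). Protocols may be deterministic, or randomized with bounded error (correct on every input with probability at least $2/3$); the protocol obtained is of the same type as the given one. $\log$ is the base-2 logarithm. Set disjointness problem: Alice holds $x \in \{0,1\}^n$, Bob holds $y \in \{0,1\}^n$, and they must determine whether there is an index $k$ with $x[k] = y[k] = 1$ (in which case $x$ and $y$ are ''not disjoint''). Orthogonal vectors problem (with $n$ vectors of dimension $d$): Alice holds a set of bit vectors $L = \{l_1,\dots,l_n\} \subseteq \{0,1\}^d$, Bob holds a set of bit vectors $R = \{r_1,\dots,r_n\}\subseteq \{0,1\}^d$, and they must determine whether there are $l_i \in L$ and $r_j \in R$ that are orthogonal, i.e., such that for every $1 \le k \le d$ we have $l_i[k] = 0$ or $r_j[k] = 0$. *)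

(* Defs.v *)
From mathcomp Require Import all_boot all_order all_algebra.
From mathcomp Require Import reals.

Set Implicit Arguments.
Unset Strict Implicit.
Unset Printing Implicit Defensive.

Import Order.TTheory GRing.Theory Num.Theory.

(** Two-party protocols as binary trees: at a node the owner sends one bit, a
    function of the owner's input (the position in the tree is the transcript so
    far); a leaf carries the common answer, so it is a function of the
    transcript alone. *)
Inductive protocol (X Y : Type) : Type :=
| Answer of bool
| AliceSends of (X -> bool) & protocol X Y & protocol X Y
| BobSends of (Y -> bool) & protocol X Y & protocol X Y.

Arguments Answer {X Y}.

Fixpoint run (X Y : Type) (p : protocol X Y) (x : X) (y : Y) : bool :=
  match p with
  | Answer a => a
  | AliceSends f p0 p1 => if f x then run p1 x y else run p0 x y
  | BobSends g p0 p1 => if g y then run p1 x y else run p0 x y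
  end.

(** Worst-case number of exchanged bits. *)
Fixpoint cost (X Y : Type) (p : protocol X Y) : nat :=
  match p with
  | Answer _ => 0
  | AliceSends _ p0 p1 | BobSends _ p0 p1 => (maxn (cost p0) (cost p1)).+1
  end.

Definition is_distribution (R : realType) (T : finType) (mu : T -> R) : Prop :=
  (forall t, 0 <= mu t)%R /\ (\sum_t mu t = 1)%R.

Definition deterministic_solves (X Y : Type) (b : nat) (f : X -> Y -> bool) :
    Prop :=
  exists p : protocol X Y, cost p <= b /\ forall x y, run p x y = f x y.

(** Private coins: each party's messages may depend on that party's own random
    string only, and the two strings are independent. *)
Definition private_coin_solves (R : realType) (X Y : Type) (b : nat)
    (f : X -> Y -> bool) : Prop :=
  exists (A B : finType) (muA : A -> R) (muB : B -> R)
         (p : protocol (X * A) (Y * B)),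
    [/\ is_distribution muA, is_distribution muB, cost p <= b &
     forall x y,
       (2%:R / 3%:R <=
        \sum_(w : A * B | run p (x, w.1) (y, w.2) == f x y)
           muA w.1 * muB w.2)%R].

(** Public coins: a distribution on deterministic protocols. *)
Definition public_coin_solves (R : realType) (X Y : Type) (b : nat)
    (f : X -> Y -> bool) : Prop :=
  exists (C : finType) (mu : C -> R) (p : C -> protocol X Y),
    [/\ is_distribution mu, forall w, cost (p w) <= b &
     forall x y,
       (2%:R / 3%:R <= \sum_(w | run (p w) x y == f x y) mu w)%R].

Inductive protocol_type := Deterministic | PrivateCoin | PublicCoin.

Definition has_protocol (R : realType) (t : protocol_type) (X Y : Type)
    (b : nat) (f : X -> Y -> bool) : Prop :=
  match t with
  | Deterministic => deterministic_solves b f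
  | PrivateCoin => private_coin_solves R b f
  | PublicCoin => public_coin_solves R b f
  end.

(** [true] means "not disjoint". *)
Definition set_disjointness (n : nat) (x y : n.-tuple bool) : bool :=
  [exists k, tnth x k && tnth y k].

Definition orthogonal_bits (d : nat) (l r : d.-tuple bool) : bool :=
  [forall k, ~~ tnth l k || ~~ tnth r k].

(** An input is a set of exactly [n] distinct vectors. A protocol for lists of
    [n] vectors, or for sets of at most [n] vectors, is in particular one for
    these inputs. *)
Definition vector_set (n d : nat) : Type :=
  {L : {set d.-tuple bool} | #|L| == n}.

Definition orthogonal_vectors (n d : nat) (L R : vector_set n d) : bool :=
  [exists l in val L, exists r in val R, orthogonal_bits l r].

(* Main.v *)
(** The [k]-th vectors of both parties start with an [m]-bit code of [k] and
    the complement of that code, in opposite orders, where [2 ^ m >= n]; these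
    [2 m] coordinates are orthogonal exactly when the two indices agree. The
    next two coordinates, [~~ x k, 1] for Alice and [1, ~~ y k] for Bob, are
    orthogonal exactly when [x k] and [y k] both hold. The codes keep the [n]
    vectors of a party distinct. The reduction is local, so it preserves the
    number of bits exchanged and the type of the protocol. *)

Require Import Defs.
From mathcomp Require Import all_boot all_order all_algebra.
From mathcomp Require Import reals.
From mathcomp Require Import zify.

Set Implicit Arguments.
Unset Strict Implicit.
Unset Printing Implicit Defensive.

Section Pullback.

Variables (X Y X' Y' : Type) (fX : X -> X') (fY : Y -> Y').

Fixpoint pullback (p : protocol X' Y') : protocol X Y :=
  match p with
  | Answer a => Answer a
  | AliceSends f p0 p1 => AliceSends (f \o fX) (pullback p0) (pullback p1)
  | BobSends g p0 p1 => BobSends (g \o fY) (pullback p0) (pullback p1)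
  end.

Lemma run_pullback p x y : run (pullback p) x y = run p (fX x) (fY y).
Proof. by elim: p => //= [f|g] p0 -> p1 ->. Qed.

Lemma cost_pullback p : cost (pullback p) = cost p.
Proof. by elim: p => //= [f|g] p0 -> p1 ->. Qed.

End Pullback.

(** Each party applies its own map before computing each message. The protocol tree keeps its shape,
    and the success event for [(x, y)] is that of the given protocol at [(fX x, fY y)]. *)
Lemma has_protocol_reduction (R : realType) (t : protocol_type)
    (X Y X' Y' : Type) (b : nat) (f : X -> Y -> bool) (g : X' -> Y' -> bool)
    (fX : X -> X') (fY : Y -> Y') :
  (forall x y, g (fX x) (fY y) = f x y) ->
  has_protocol R t b g -> has_protocol R t b f.
Proof.
move=> gE; case: t => /=.
- move=> [p [cost_p run_p]]; exists (pullback fX fY p).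
  by rewrite cost_pullback; split=> // x y; rewrite run_pullback run_p gE.
- move=> [A [B [muA [muB [p [dA dB cost_p succ]]]]]].
  exists A, B, muA, muB.
  (* Only the inputs are mapped; the private coins pass through unchanged. *)
  exists (pullback (fun u => (fX u.1, u.2)) (fun v => (fY v.1, v.2)) p).
  rewrite cost_pullback; split=> // x y; rewrite -gE.
  by under eq_bigl do rewrite run_pullback; apply: succ.
- move=> [C [mu [p [dC cost_p succ]]]].
  exists C, mu, (fun w => pullback fX fY (p w)).
  split=> // [w|x y]; first by rewrite cost_pullback.
  by rewrite -gE; under eq_bigl do rewrite run_pullback; apply: succ.
Qed.

(* Only two coordinates are needed after the code; the third is always 0. *)
Definition gadget (m : nat) (c : nat -> bool) (u v : bool) :
    (2 * m + 3).-tuple bool :=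
  [tuple if i < m then c i else if i < 2 * m then ~~ c (i - m)
         else if i == 2 * m :> nat then u else (i == (2 * m).+1 :> nat) && v
  | i < 2 * m + 3].

Lemma gadget_code (m : nat) (c c' : nat -> bool) (u v u' v' : bool) :
  gadget m c u v = gadget m c' u' v' -> forall i, i < m -> c i = c' i.
Proof.
move=> eq_g i lt_im; have lt_id : i < 2 * m + 3 by lia.
move/(congr1 (fun w => tnth w (Ordinal lt_id))): eq_g.
by rewrite !tnth_mktuple lt_im.
Qed.

Lemma orthogonal_gadget (m : nat) (c c' : nat -> bool) (a a' : bool) :
  reflect ((forall i, i < m -> c i = c' i) /\ a && a')
    (orthogonal_bits (gadget m c (~~ a) true)
                     (gadget m (negb \o c') true (~~ a'))).
Proof.
apply: (iffP forallP) => [orth|[eq_c /andP[-> ->]] i]; last first.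
  rewrite !tnth_mktuple /=; have [lt_im|ge_im] := ltnP i m.
    by rewrite eq_c // negbK orNb.
  have [lt_i2m|_] := ltnP i (2 * m).
    by rewrite eq_c ?negbK; [case: (c' _) | lia].
  by case: eqP; rewrite ?andbF ?orbT.
have coord i (lt_i : i < 2 * m + 3) := orth (Ordinal lt_i).
split=> [i lt_im|].
  (* Coordinate [i] says that [c i] implies [c' i]; coordinate [m + i] gives the converse. *)
  have := coord i ltac:(lia); have := coord (m + i) ltac:(lia).
  rewrite !tnth_mktuple /= lt_im ltnNge leq_addr /= addKn.
  have -> : m + i < 2 * m by lia.
  by case: (c i); case: (c' i).
(* Coordinate [2 * m] forces [a], and the next one forces [a']. *)
have := coord (2 * m) ltac:(lia); have := coord (2 * m).+1 ltac:(lia).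
rewrite !tnth_mktuple /= eqxx ltnn.
have -> : (2 * m < m) = false by lia.
have -> : ((2 * m).+1 < m) = false by lia.
have -> : ((2 * m).+1 < 2 * m) = false by lia.
have -> : ((2 * m).+1 == 2 * m) = false by lia.
by rewrite eqxx {orth coord}; case: a; case: a'.
Qed.

(** There are [2 ^ m] tuples of [m] bits, so the [k]-th one in their enumeration can serve as the
    code of [k]. *)
Lemma index_code (n m : nat) :
  n <= 2 ^ m ->
  exists c : 'I_n -> nat -> bool,
    forall j k, (forall i, i < m -> c j i = c k i) -> j = k.
Proof.
move=> le_n; have le_card : n <= #|{: m.-tuple bool}|.
  by rewrite card_tuple card_bool.
pose code k : m.-tuple bool := enum_val (widen_ord le_card k).
exists (fun k => nth false (code k)) => j k eq_c.
have /enum_val_inj eq_jk : code j = code k.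
  apply/val_inj/(@eq_from_nth _ false) => [|i]; rewrite !size_tuple //.
  exact: eq_c.
by apply: val_inj; apply: (congr1 val eq_jk).
Qed.

Lemma card_image_vector_set (n d : nat) (v : 'I_n -> d.-tuple bool) :
  injective v -> #|v @: 'I_n| == n.
Proof. by move=> v_inj; rewrite card_imset // card_ord. Qed.

Theorem theorem2p1 (R : realType) (t : protocol_type) (n b : nat)
    (n_ge1 : 1 <= n) :
  let d := 2 * up_log 2 n + 3 in
  has_protocol R t b (@orthogonal_vectors n d) ->
  has_protocol R t b (@set_disjointness n).
Proof.
set m := up_log 2 n => d.
have [c c_inj] : exists c : 'I_n -> nat -> bool,
    forall j k, (forall i, i < m -> c j i = c k i) -> j = k.
  exact/index_code/up_logP.
pose vA (x : n.-tuple bool) k : d.-tuple bool :=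
  gadget m (c k) (~~ tnth x k) true.
pose vB (y : n.-tuple bool) k : d.-tuple bool :=
  gadget m (negb \o c k) true (~~ tnth y k).
have vA_inj x : injective (vA x) by move=> j k /gadget_code/c_inj.
have vB_inj y : injective (vB y).
  (* Bob's first [m] coordinates hold the complemented code, which determines the code. *)
  by move=> j k /gadget_code eq_c; apply: c_inj => i /eq_c /negb_inj.
pose fA x : vector_set n d :=
  Sub (vA x @: 'I_n) (card_image_vector_set (vA_inj x)).
pose fB y : vector_set n d :=
  Sub (vB y @: 'I_n) (card_image_vector_set (vB_inj y)).
apply: (has_protocol_reduction (fX := fA) (fY := fB)) => x y.
apply/exists_inP/existsP => [[_ /imsetP[j _ ->]]|[k xy_k]].
  (* Orthogonality makes the two codes agree, so both vectors come from the same index [j]. *)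
  case/exists_inP=> _ /imsetP[k _ ->] /orthogonal_gadget[/c_inj <- xy_j].
  by exists j.
exists (vA x k); first exact: imset_f.
apply/exists_inP; exists (vB y k); first exact: imset_f.
exact/orthogonal_gadget.
Qed.
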